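(* Let $D$ be a noncommutative division ring and let $R = M_{m}(D)$ with $m > 1$. Let $n$ be a nonnegative integer, and suppose that additive mappings $f, g : R \rightarrow R$ satisfy $f(X) = X^{n} g(X^{-1})$ for all $X \in R^{\times}$. Then: (i) If $n = 2$, then $f = g$ and $f(X) = X f(I)$ for each $X \in R$. (ii) If $n \neq 2$, then $f = g = 0$.
   Context: $M_m(D)$ denotes the ring of $m \times m$ matrices over $D$, $I$ is its identity matrix, and $R^{\times}$ is the set of all invertible elements of $R$. Rings are associative with unity. A mapping $f: R \to R$ is additive if $f(X+Y) = f(X) + f(Y)$ for all $X, Y \in R$. The characteristic of $D$ is arbitrary. *)

(* Defs.v *)
From HB Require Import structures.
From mathcomp Require Import all_boot all_order all_algebra.

Set Implicit Arguments.
Unset Strict Implicit.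
Unset Printing Implicit Defensive.

Import GRing.Theory.
Local Open Scope ring_scope.

Definition division_ring (D : unitRingType) : Prop :=
  forall x : D, x != 0 -> x \is a GRing.unit.

(* The library equips 'M[D]_m with GRing.unit and ^-1 only when D is
   commutative, so invertibility in 'M[D]_m is expressed relationally:
   y is the (necessarily unique) two-sided inverse of x. *)
Definition is_inverse (R : pzRingType) (x y : R) : Prop :=
  x * y = 1 /\ y * x = 1.

(* Main.v *)
Require Import Defs.
From HB Require Import structures.
From mathcomp Require Import all_boot all_order all_algebra.
From mathcomp Require Import finfield.

Set Implicit Arguments.
Unset Strict Implicit.
Unset Printing Implicit Defensive.

Import GRing.Theory.
Local Open Scope ring_scope.

(** Write e_ij for the matrix units and E_ij(a) for a e_ij.

    Suppose first that n > 0.  On a unit x e_ii + y e_jj + (1 - e_ii - e_jj) the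
    j-th row of the identity reads
      e_jj f(X) = y^n e_jj g(X^-1).
    Subtracting its instances for two values of x leaves a relation between
    e_jj f((x - x') e_ii) and y^n e_jj g((1/x - 1/x') e_ii) in which y is free.
    If some d <> 0 in D has d^n <> 1, comparing y = 1 with y = d forces
    e_jj f(z e_ii) = 0 for all z: f sends the corner e_ii R e_ii into the row
    e_ii R.  The argument survives conjugation by any invertible P, since
    conjugation commutes with powers and inverses ([conj_corner_row]).
    Taking for P the shears 1 + E_ji(a) turns this inclusion of rows into
    f(E_ji(ad)) = E_ji(a) f(E_ii(d)) ([shifted_corner]), whence f(X) = X f(1)
    ([right_multiplication]).  The identity is symmetric in f and g, so
    g(X) = X g(1) too, and f(1) = g(1) =: c.  On scalar matrices it becomes
    d c = d^(n-1) c, so that c <> 0 would give d^n = d^2 for all d <> 0.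

    If n = 0 the powers disappear and no such comparison is available.  Instead,
    f(X) = g(X^-1) is applied to the triangular units (d, da; 0, 1) and to the
    units (0, b; 1, d): the free parameter, d in the first and b in the second,
    enters only one of the two sides after subtracting, which kills f and g on
    all matrix units ([inverse_swap_diag_eq0]).

    The noncommutativity of D enters through the fact that no power map z |-> z^k
    with k > 0 is identically 1 on D \ {0} ([torsion_division_ring_comm], a
    case of Jacobson's theorem).  This fact is false for finite fields, and over
    these the theorem fails as well: M_m(F) has a finite unit group, of exponent
    N say, and n = N + 2 acts like n = 2.

    To prove that fact, suppose that z^k = 1 for all z <> 0 and that a is not
    central.  Then conjugation by a has an eigenvector y outside the centralizer
    of a, with eigenvalue a power of a ([conjugation_eigenvector]).  So y
    normalizes the cyclic group generated by a, the subring generated by a and y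
    is finite, and Wedderburn's little theorem makes a and y commute: a
    contradiction. *)

(** * Finite division subrings *)

Lemma division_ring_mulf_eq0 (D : unitRingType) :
  division_ring D -> GRing.integral_domain_axiom D.
Proof.
move=> hD x y xy0; have [//|/hD ux /=] := eqVneq x 0.
by rewrite -(mulKr ux y) xy0 mulr0.
Qed.

(** Wedderburn's little theorem for a finite subring given by a list of its
    elements: it is transported from the finite type of members of the list. *)
Lemma finite_division_subring_comm (D : unitRingType) (s : seq D) :
    division_ring D -> divring_closed (mem s) ->
  {in s &, commutative (@GRing.mul D)}.
Proof.
move=> hD cl x y xs ys.
pose mixin := GRing.SubChoice_isSubUnitRing.Build D _ (seq_sub s) cl.
pose R : finUnitRingType := HB.pack (seq_sub s) mixin.
have RM (u v : R) : ssval (u * v) = ssval u * ssval v by [].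
have R0 : ssval (0 : R) = 0 by [].
have domR : GRing.integral_domain_axiom R.
  move=> u v /(congr1 (@ssval _ s)); rewrite RM R0.
  move=> /(division_ring_mulf_eq0 hD) uv0.
  have eq0 (w : R) : ssval w == 0 -> w == 0.
    by move=> /eqP w0; apply/eqP; apply: val_inj; exact: etrans w0 (esym R0).
  by case/orP: uv0 => /eq0->; rewrite ?orbT.
have := finDomain_mulrC domR (SeqSub xs : R) (SeqSub ys : R).
by move=> /(congr1 (@ssval _ s)); rewrite !RM.
Qed.

(** The additive span of the monomials a^i y^j with i, j < k in characteristic
    dividing p.  Presenting it as a list, with coefficients below p, makes it
    finite by construction. *)
Definition two_generator_sums (D : pzRingType) (k p : nat) (a y : D) : seq D :=
  [seq \sum_(u : 'I_k * 'I_k) (a ^+ u.1 * y ^+ u.2 *+ c u)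
     | c : {ffun 'I_k * 'I_k -> 'I_p}].

Section TwoGenerators.
Variables (D : unitRingType) (k p r : nat) (a y : D).
Hypotheses (k_gt0 : (0 < k)%N) (p_gt0 : (0 < p)%N) (p0 : p%:R = 0 :> D).
Hypotheses (ak : a ^+ k = 1) (yk : y ^+ k = 1) (ya : y * a = a ^+ r * y).

Local Notation S := (two_generator_sums k p a y).

Lemma two_generator_sums_mem (c : 'I_k * 'I_k -> nat) :
  \sum_(u : 'I_k * 'I_k) (a ^+ u.1 * y ^+ u.2 *+ c u) \in S.
Proof.
apply/imageP; exists [ffun u => Ordinal (ltn_pmod (c u) p_gt0)] => //.
apply: eq_bigr => u _; rewrite ffunE /= {1}(divn_eq (c u) p).
rewrite mulrnDr mulnC mulrnA -[in X in X *+ _ + _]mulr_natr.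
by rewrite p0 mulr0 mul0rn add0r.
Qed.

(** Coefficients may be arbitrary natural numbers since p = 0 in D.  In this form
    closure under addition needs no reduction modulo p. *)
Lemma two_generator_sumsP z :
  reflect (exists c : 'I_k * 'I_k -> nat,
             z = \sum_(u : 'I_k * 'I_k) (a ^+ u.1 * y ^+ u.2 *+ c u)) (z \in S).
Proof.
apply: (iffP idP) => [/imageP[c _ ->]|[c ->]].
  by exists (fun u => c u : nat).
exact: two_generator_sums_mem.
Qed.

Lemma two_generator_sumsD : {in S &, forall z t, z + t \in S}.
Proof.
move=> _ _ /two_generator_sumsP[c ->] /two_generator_sumsP[d ->].
apply/two_generator_sumsP; exists (fun u => (c u + d u)%N).
by rewrite -big_split; apply: eq_bigr => u _; rewrite mulrnDr.
Qed.

Lemma two_generator_sums0 : 0 \in S.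
Proof.
apply/two_generator_sumsP; exists (fun=> 0%N).
by rewrite big1 // => u _; rewrite mulr0n.
Qed.

Lemma two_generator_sumsMn z n : z \in S -> z *+ n \in S.
Proof.
move=> zS; elim: n => [|n IHn]; first exact: two_generator_sums0.
by rewrite mulrS two_generator_sumsD.
Qed.

Lemma two_generator_sums_sum (I : finType) (F : I -> D) :
  (forall i, F i \in S) -> \sum_i F i \in S.
Proof.
move=> FS; apply: (big_ind (fun z => z \in S)) => [|z t|i _].
- exact: two_generator_sums0.
- exact: two_generator_sumsD.
- exact: FS.
Qed.

Lemma two_generator_sums_monomial i j : a ^+ i * y ^+ j \in S.
Proof.
pose u0 := (Ordinal (ltn_pmod i k_gt0), Ordinal (ltn_pmod j k_gt0)).
apply/two_generator_sumsP; exists (fun u => nat_of_bool (u == u0)).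
rewrite (bigD1 u0) //= eqxx mulr1n big1 => [|u /negbTE->//].
by rewrite addr0 !expr_mod.
Qed.

Lemma two_generator_exchange i j : y ^+ j * a ^+ i = a ^+ (r ^ j * i) * y ^+ j.
Proof.
have step l : y * a ^+ l = a ^+ (r * l) * y.
  elim: l => [|l IHl]; first by rewrite muln0 mulr1 mul1r.
  by rewrite exprS mulrA ya -mulrA IHl mulrA -exprD mulnS.
elim: j i => [|j IHj] i; first by rewrite mul1n mulr1 mul1r.
by rewrite exprSr -mulrA step mulrA IHj -mulrA expnSr mulnA.
Qed.

(** The relation y a = a^r y moves all powers of a to the left, so a product of
    monomials is again a monomial. *)
Lemma two_generator_sumsM : {in S &, forall z t, z * t \in S}.
Proof.
move=> _ _ /two_generator_sumsP[c ->] /two_generator_sumsP[d ->].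
rewrite mulr_suml; apply: two_generator_sums_sum => u.
rewrite mulr_sumr; apply: two_generator_sums_sum => v.
rewrite mulrnAl mulrnAr; do 2 apply: two_generator_sumsMn.
rewrite mulrA -(mulrA _ (y ^+ _)) two_generator_exchange mulrA -exprD.
by rewrite -mulrA -exprD two_generator_sums_monomial.
Qed.

(** Opposites and inverses come for free: - t = (p - 1) t and t^-1 = t^(k-1). *)
Lemma two_generator_sums_closed :
    division_ring D -> (forall z : D, z != 0 -> z ^+ k = 1) ->
  divring_closed (mem S).
Proof.
move=> hD expD.
have S1 : 1 \in S by have := two_generator_sums_monomial 0 0; rewrite mulr1.
split=> // [z t zS tS|z t zS tS].
  suff -> : - t = t *+ p.-1 by rewrite two_generator_sumsD ?two_generator_sumsMn.
  apply/eqP; rewrite eq_sym -addr_eq0 -mulrSr prednK //.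
  by rewrite -mulr_natr p0 mulr0.
apply: (two_generator_sumsM zS); have [->|t0] := eqVneq t 0.
  by rewrite invr0 two_generator_sums0.
have -> : t^-1 = t ^+ k.-1.
  by apply: (mulrI (hD _ t0)); rewrite divrr ?hD // -exprS prednK ?expD.
by elim: k.-1 => // l IHl; rewrite exprS two_generator_sumsM.
Qed.

End TwoGenerators.

(** * Division rings of finite exponent are commutative *)

(** If 2 <> 0 then 2^k = 1, so the positive integer 2^k - 1 vanishes in D. *)
Lemma torsion_division_ring_pchar (D : unitRingType) (k : nat) :
    division_ring D -> (0 < k)%N -> (forall z : D, z != 0 -> z ^+ k = 1) ->
  exists p, p \in [pchar D].
Proof.
move=> hD k_gt0 expD.
have [M M_gt0 M0] : exists2 M : nat, (0 < M)%N & M%:R = 0 :> D.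
  have [D20|/expD D2k] := eqVneq (2%:R : D) 0; first by exists 2%N.
  exists (2 ^ k).-1.
    by rewrite -ltnS prednK ?expn_gt0 // -{1}(expn0 2) ltn_exp2l.
  by apply: (addIr 1); rewrite -mulrSr prednK ?expn_gt0 // natrX D2k add0r.
elim/ltn_ind: M M_gt0 M0 => M IHM M_gt0 M0.
have [M_le1|M_gt1] := leqP M 1.
  by have M1 : M = 1%N; [apply/eqP; rewrite eqn_leq M_le1|
    case/eqP: (oner_neq0 D); rewrite -M0 M1].
have [p0|p_neq0] := eqVneq ((pdiv M)%:R : D) 0.
  by exists (pdiv M); rewrite inE /= pdiv_prime // p0 eqxx.
apply: (IHM (M %/ pdiv M)%N).
- by rewrite ltn_Pdiv // prime_gt1 ?pdiv_prime.
- by rewrite divn_gt0 ?pdiv_gt0 // pdiv_leq.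
- apply: (mulIr (hD _ p_neq0)); rewrite mul0r -natrM divnK ?pdiv_dvd //.
Qed.

(** In characteristic p the order e of a is prime to p: were e = p e', then
    (a^e' - 1)^p = a^e - 1 = 0 would give a^e' = 1. *)
Lemma order_natr_neq0 (D : unitRingType) (p e : nat) (a : D) :
    division_ring D -> p \in [pchar D] -> (0 < e)%N -> a ^+ e = 1 ->
    (forall j, (0 < j < e)%N -> a ^+ j != 1) ->
  e%:R != 0 :> D.
Proof.
move=> hD pD e_gt0 ae min_e; rewrite -(dvdn_pcharf pD).
apply/negP => /dvdnP[e' De].
have p_pr := pcharf_prime pD.
have e'_gt0 : (0 < e')%N by move: e_gt0; rewrite De muln_gt0 => /andP[].
have e'_lt : (0 < e' < e)%N by rewrite e'_gt0 De ltn_Pmulr ?prime_gt1.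
case/eqP: (min_e _ e'_lt); apply/eqP; rewrite -subr_eq0.
apply/negPn/negP => /hD /(unitrX p).
have := pFrobenius_autB_comm pD (commr1 (a ^+ e')).
rewrite !pFrobenius_autE => ->.
by rewrite -exprM -De ae expr1n subrr unitr0.
Qed.

(** Lagrange resolvents.  Conjugation by a has order dividing e, and the powers
    of a are e distinct e-th roots of unity, so the sums
      y_i = sum_(j < e) a^(-ij) (a^j x a^-j)
    satisfy a y_i a^-1 = a^i y_i and add up to e x.  As e is invertible and x
    does not commute with a, neither does some y_i. *)
Lemma conjugation_eigenvector (D : unitRingType) (e : nat) (a x : D) :
    division_ring D -> (0 < e)%N -> a ^+ e = 1 ->
    (forall j, (0 < j < e)%N -> a ^+ j != 1) -> e%:R != 0 :> D ->
    a * x <> x * a ->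
  exists2 y, a * y <> y * a & exists i, a * y = a ^+ i * y * a.
Proof.
move=> hD e_gt0 ae min_e e_neq0 ax.
have ua : a \is a GRing.unit.
  by apply/unitrP; exists (a ^+ e.-1); rewrite -exprS -exprSr prednK.
pose v := a^-1.
have va : v * a = 1 by rewrite mulVr.
have av : a * v = 1 by rewrite divrr.
have ve : v ^+ e = 1 by rewrite exprVn ae invr1.
pose T i j := v ^+ (i * j) * a ^+ j * x * v ^+ j.
pose y i := \sum_(j < e) T i j.
have y_eig i : a * y i = a ^+ i * y i * a.
  have shift : \sum_(j < e) T i j.+1 = y i.
    (* The terms are e-periodic in j. *)
    rewrite /y; case: (e) e_gt0 ae ve => // e1 _ ae1 ve1.
    rewrite big_ord_recr big_ord_recl /= addrC; congr (_ + _).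
    by rewrite /T ae1 ve1 muln0 mulnC exprM ve1 expr1n.
  rewrite -[in RHS]shift [LHS]mulr_sumr [X in _ = X * _]mulr_sumr mulr_suml.
  apply: eq_bigr => j _; rewrite /T.
  rewrite mulnS exprD !mulrA.
  have -> : a ^+ i * v ^+ i = 1.
    by rewrite -exprMn_comm ?av ?expr1n // /GRing.comm av va.
  rewrite mul1r [v ^+ j.+1]exprSr !mulrA -(mulrA _ v a) va mulr1.
  rewrite [a ^+ j.+1]exprS !mulrA; congr (_ * _ * _ * _).
  apply: commrX; rewrite /GRing.comm.
  by rewrite av va.
have sum_y : \sum_(i < e) y i = x *+ e.
  (* For fixed j > 0 the sum over i is geometric, of ratio a^-j <> 1. *)
  rewrite exchange_big /=.
  have inner (j : 'I_e) : (0 < j)%N -> \sum_(i < e) T i j = 0.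
    move=> j_gt0; pose w := v ^+ j.
    have w_neq1 : w - 1 != 0.
      have := min_e j; rewrite j_gt0 ltn_ord => /(_ isT) aj; rewrite subr_eq0.
      apply: contraNneq aj => w1; apply/eqP.
      have : (v * a) ^+ j = w * a ^+ j.
        by rewrite exprMn_comm // /GRing.comm av va.
      by rewrite va expr1n w1 mul1r.
    have geom : \sum_(i < e) w ^+ i = 0.
      apply: (mulrI (hD _ w_neq1)).
      by rewrite -subrX1 mulr0 /w -exprM mulnC exprM ve expr1n subrr.
    transitivity ((\sum_(i < e) w ^+ i) * (a ^+ j * x * v ^+ j)).
      rewrite mulr_suml; apply: eq_bigr => i _.
      by rewrite /T /w -exprM mulnC !mulrA.
    by rewrite geom mul0r.
  case: (e) e_gt0 inner => // e1 _ inner.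
  rewrite big_ord_recl [X in _ + X]big1 => [|j _]; last first.
    exact: (inner (lift ord0 j) isT).
  rewrite addr0 (eq_bigr (fun=> x)) => [|i _].
    by rewrite sumr_const card_ord.
  by rewrite /T muln0 !mulr1 mul1r.
have [/existsP[i /eqP yi]|/existsPn comm_y] :=
    boolP [exists i : 'I_e, a * y i != y i * a].
  by exists (y i) => //; exists i; apply: y_eig.
case: ax; apply: (mulIr (hD _ e_neq0)).
rewrite !mulr_natr -mulrnAr -mulrnAl -sum_y mulr_sumr mulr_suml.
by apply: eq_bigr => i _; apply/eqP; move: (comm_y i); rewrite negbK.
Qed.

(** If a and x do not commute, the eigenvector y furnished by x satisfies
    y a = a^(1-i) y, so a and y generate a finite subring. *)
Theorem torsion_division_ring_comm (D : unitRingType) (k : nat) :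
    division_ring D -> (0 < k)%N -> (forall z : D, z != 0 -> z ^+ k = 1) ->
  commutative (@GRing.mul D).
Proof.
move=> hD k_gt0 expD a x; apply/eqP/negPn/negP => /eqP ax.
have [p pD] := torsion_division_ring_pchar hD k_gt0 expD.
have p_gt0 : (0 < p)%N := prime_gt0 (pcharf_prime pD).
have a_neq0 : a != 0 by apply: contra_notN ax => /eqP->; rewrite mul0r mulr0.
have ex_e : exists e, (0 < e)%N && (a ^+ e == 1).
  by exists k; rewrite k_gt0 expD /=.
case: (ex_minnP ex_e) => e /andP[e_gt0 /eqP ae] min_e.
have {}min_e j : (0 < j < e)%N -> a ^+ j != 1.
  case/andP=> j_gt0; rewrite ltnNge; apply: contraNN => aj.
  by apply: min_e; rewrite j_gt0.
have e_neq0 := order_natr_neq0 hD pD e_gt0 ae min_e.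
have [y ay [i y_eig]] := conjugation_eigenvector hD e_gt0 ae min_e e_neq0 ax.
have y_neq0 : y != 0 by apply: contra_notN ay => /eqP->; rewrite mul0r mulr0.
(* The exponent is 1 - i modulo the order e of a. *)
have ya : y * a = a ^+ (e.-1 * i).+1 * y.
  rewrite exprSr -mulrA y_eig !mulrA -exprD addnC -mulSn prednK //.
  by rewrite exprM ae expr1n mul1r.
have cl := two_generator_sums_closed k_gt0 p_gt0 (pcharf0 pD) (expD _ a_neq0)
  (expD _ y_neq0) ya hD expD.
have mono := two_generator_sums_monomial k_gt0 p_gt0 (pcharf0 pD) (expD _ a_neq0)
  (expD _ y_neq0).
apply: ay; apply: (finite_division_subring_comm hD cl).
  by have := mono 1%N 0%N; rewrite mulr1.
by have := mono 0%N 1%N; rewrite mul1r.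
Qed.

(** Noncommutativity is a negation, so it yields the element d only up to double
    negation; this is enough for a boolean goal P. *)
Lemma noncomm_expr_neq1 (D : unitRingType) (k : nat) (P : bool) :
    division_ring D -> ~ commutative (@GRing.mul D) -> (0 < k)%N ->
  (forall d : D, d != 0 -> d ^+ k != 1 -> P) -> P.
Proof.
move=> hD hnc k_gt0 dP; apply/negPn/negP => nP; apply: hnc.
apply: torsion_division_ring_comm hD k_gt0 _ => d d0; apply/eqP/negPn/negP => dk.
by case/negP: nP; apply: dP dk.
Qed.

Lemma noncomm_nonzero_neq (D : unitRingType) (t : D) (P : bool) :
    ~ commutative (@GRing.mul D) ->
  (forall x : D, x != 0 -> x != t -> P) -> P.
Proof.
move=> hnc xP; apply/negPn/negP => nP; apply: hnc => x y.
have D2 z : z = 0 \/ z = t.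
  have [->|z0] := eqVneq z 0; [by left|have [->|zt] := eqVneq z t; first by right].
  by case/negP: nP; apply: xP zt.
by case: (D2 x) (D2 y) => [] -> [] ->; rewrite ?(mulr0, mul0r).
Qed.

Lemma scale_divring_eq0 (D : unitRingType) (V : lmodType D) (a : D) (v : V) :
  division_ring D -> a != 0 -> a *: v = 0 -> v = 0.
Proof.
by move=> hD /hD ua av0; rewrite -[v]scale1r -(mulVr ua) -scalerA av0 scaler0.
Qed.

(** * Matrix units and two-by-two blocks *)

Section MatrixUnits.
Variables (D : unitRingType) (m : nat).
Implicit Types (i j k l : 'I_m) (a b c d : D).

Lemma mulr_scalemxl a (X Y : 'M[D]_m) : (a *: X) * Y = a *: (X * Y).
Proof. exact/esym/scalemxAl. Qed.

Definition elem_mx i j a : 'M[D]_m := a *: delta_mx i j.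

Lemma elem_mx0 i j : elem_mx i j 0 = 0. Proof. exact: scale0r. Qed.

Lemma elem_mxD i j a b : elem_mx i j (a + b) = elem_mx i j a + elem_mx i j b.
Proof. exact: scalerDl. Qed.

Lemma elem_mxN i j a : elem_mx i j (- a) = - elem_mx i j a.
Proof. exact: scaleNr. Qed.

Lemma elem_mxB i j a b : elem_mx i j (a - b) = elem_mx i j a - elem_mx i j b.
Proof. exact: scalerBl. Qed.

Lemma elem_mxM i j l a b : elem_mx i j a * elem_mx j l b = elem_mx i l (a * b).
Proof.
rewrite /elem_mx -mulmxE; apply/matrixP => r s.
rewrite mxE (bigD1 j) //= big1 => [|t /negbTE tj].
  by rewrite !mxE !eqxx andbT addr0; case: (r == i); case: (s == l);
    rewrite /= ?(mulr1, mul1r, mulr0, mul0r).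
by rewrite !mxE tj andbF mulr0 mul0r.
Qed.

Lemma elem_mxM_neq i j k l a b : j != k -> elem_mx i j a * elem_mx k l b = 0.
Proof.
move=> /negbTE jk; rewrite -mulmxE; apply/matrixP => r s.
rewrite !mxE big1 // => t _.
rewrite !mxE; have [->|_] := eqVneq t j; first by rewrite jk /= !mulr0.
by rewrite andbF mulr0 mul0r.
Qed.

Lemma sum_elem_mx : \sum_i elem_mx i i 1 = 1.
Proof.
apply/matrixP => r s; rewrite summxE (bigD1 r) //= big1 => [|t /negbTE tr].
  by rewrite !mxE eqxx addr0; case: (s == r) (eq_sym r s) => ->; rewrite ?mulr1 ?mulr0.
by rewrite !mxE [r == t]eq_sym tr mulr0.
Qed.

(** The matrix (a, b; c, d) placed in the rows and columns i, j, completed by the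
    identity elsewhere. *)
Definition block2 i j a b c d : 'M[D]_m :=
  (1 - elem_mx i i 1 - elem_mx j j 1)
  + (elem_mx i i a + elem_mx i j b + (elem_mx j i c + elem_mx j j d)).

Lemma block2_1 i j : block2 i j 1 0 0 1 = 1.
Proof. by rewrite /block2 !elem_mx0 addr0 add0r -[1 - _ - _]addrA -opprD subrK. Qed.

Lemma block2B i j a b c d a' b' c' d' :
  block2 i j a b c d - block2 i j a' b' c' d' =
  elem_mx i i (a - a') + elem_mx i j (b - b')
  + (elem_mx j i (c - c') + elem_mx j j (d - d')).
Proof.
rewrite /block2 opprD addrACA subrr add0r !elem_mxB.
by rewrite opprD addrACA !opprD; congr (_ + _); rewrite addrACA.
Qed.

Lemma block2M i j a b c d a' b' c' d' : i != j ->
  block2 i j a b c d * block2 i j a' b' c' d' =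
  block2 i j (a * a' + b * c') (a * b' + b * d')
             (c * a' + d * c') (c * b' + d * d').
Proof.
move=> ij; have ji : j != i by rewrite eq_sym.
rewrite /block2; set Z := 1 - _ - _.
have Zl k l x : (k == i) || (k == j) -> Z * elem_mx k l x = 0.
  rewrite /Z !mulrBl mul1r; case/orP=> /eqP->.
    by rewrite elem_mxM (elem_mxM_neq _ _ _ _ ji) mul1r subrr subr0.
  by rewrite elem_mxM (elem_mxM_neq _ _ _ _ ij) mul1r subr0 subrr.
have Zr k l x : (l == i) || (l == j) -> elem_mx k l x * Z = 0.
  rewrite /Z !mulrBr mulr1; case/orP=> /eqP->.
    by rewrite elem_mxM (elem_mxM_neq _ _ _ _ ij) mulr1 subrr subr0.
  by rewrite elem_mxM (elem_mxM_neq _ _ _ _ ji) mulr1 subr0 subrr.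
have ZZ : Z * Z = Z by rewrite {2}/Z !mulrBr mulr1 !Zl ?eqxx ?orbT // !subr0.
set M := (X in Z + X); set M' := (X in _ * (Z + X)).
have ZM : Z * M' = 0 by rewrite !mulrDr !Zl ?eqxx ?orbT // !addr0.
have MZ : M * Z = 0 by rewrite !mulrDl !Zr ?eqxx ?orbT // !addr0.
rewrite mulrDl [Z * _]mulrDr [M * _]mulrDr ZZ ZM MZ addr0 add0r.
congr (_ + _); rewrite /M /M'.
rewrite !(mulrDl, mulrDr) !elem_mxM !(elem_mxM_neq _ _ _ _ ij)
  !(elem_mxM_neq _ _ _ _ ji) !addr0 !add0r.
by rewrite !elem_mxD; congr (_ + _); rewrite addrACA.
Qed.

Lemma block2_inverse i j a b c d a' b' c' d' : i != j ->
    a * a' + b * c' = 1 -> a * b' + b * d' = 0 ->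
    c * a' + d * c' = 0 -> c * b' + d * d' = 1 ->
    a' * a + b' * c = 1 -> a' * b + b' * d = 0 ->
    c' * a + d' * c = 0 -> c' * b + d' * d = 1 ->
  is_inverse (block2 i j a b c d) (block2 i j a' b' c' d').
Proof.
move=> ij h1 h2 h3 h4 h5 h6 h7 h8.
by split; rewrite block2M // ?h1 ?h2 ?h3 ?h4 ?h5 ?h6 ?h7 ?h8 block2_1.
Qed.

Lemma block2_diag_inverse i j a b : division_ring D -> i != j ->
  a != 0 -> b != 0 ->
  is_inverse (block2 i j a 0 0 b) (block2 i j a^-1 0 0 b^-1).
Proof.
move=> hD ij /hD ua /hD ub.
by apply: block2_inverse;
  rewrite // ?(mul0r, mulr0, addr0, add0r) ?divrr ?mulVr.
Qed.

Lemma row_block2_diag i j a b n : i != j ->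
  elem_mx j j 1 * block2 i j a 0 0 b ^+ n = b ^+ n *: elem_mx j j 1.
Proof.
move=> ij; have ji : j != i by rewrite eq_sym.
have step : elem_mx j j 1 * block2 i j a 0 0 b = b *: elem_mx j j 1.
  rewrite /block2 !elem_mx0 addr0 add0r !(mulrDr, mulrBr, mulrN) mulr1.
  rewrite !elem_mxM !(elem_mxM_neq _ _ _ _ ji) !mul1r subr0 subrr !add0r.
  by rewrite /elem_mx scale1r.
elim: n => [|n IHn]; first by rewrite mulr1 scale1r.
by rewrite !exprS mulrA step mulr_scalemxl IHn scalerA.
Qed.

Lemma shear_inverse i j a : i != j ->
  is_inverse (1 + elem_mx i j a) (1 - elem_mx i j a).
Proof.
move=> ij; have ji : j != i by rewrite eq_sym.
have NN : elem_mx i j a * elem_mx i j a = 0 by rewrite elem_mxM_neq.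
split.
  by rewrite mulrDl mul1r mulrBr mulr1 NN subr0 subrK.
by rewrite mulrBl mul1r mulrDr mulr1 NN addr0 addrK.
Qed.

Lemma scalar_matrixX d n :
  (d *: (1 : 'M[D]_m)) ^+ n = d ^+ n *: (1 : 'M[D]_m).
Proof.
elim: n => [|n IHn]; first by rewrite scale1r.
by rewrite !exprS IHn mulr_scalemxl mul1r scalerA.
Qed.

Lemma scalar_matrix_inverse d : division_ring D -> d != 0 ->
  is_inverse (d *: (1 : 'M[D]_m)) (d^-1 *: (1 : 'M[D]_m)).
Proof.
move=> hD /hD ud.
by split; rewrite mulr_scalemxl mul1r scalerA ?divrr ?mulVr // scale1r.
Qed.

Lemma row_supported i (X : 'M[D]_m) :
  (forall l, l != i -> elem_mx l l 1 * X = 0) -> X = elem_mx i i 1 * X.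
Proof.
move=> X0; rewrite -[LHS]mul1r -sum_elem_mx mulr_suml (bigD1 i) //=.
by rewrite big1 ?addr0.
Qed.

End MatrixUnits.

(** * The identity with a positive exponent *)

Lemma ord_exists_neq (k : nat) (i : 'I_k) : (1 < k)%N -> exists j : 'I_k, j != i.
Proof.
move=> k_gt1; have lt0 : (0 < k)%N by apply: ltn_trans k_gt1.
have [->|i0] := eqVneq i (Ordinal lt0); first by exists (Ordinal k_gt1).
by exists (Ordinal lt0); rewrite eq_sym.
Qed.

Lemma conj_expr (R : pzRingType) (P Q X : R) k : is_inverse P Q ->
  (P * X * Q) ^+ k = P * X ^+ k * Q.
Proof.
case=> PQ QP; elim: k => [|k IHk]; first by rewrite mulr1 PQ.
by rewrite !exprS IHk !mulrA -(mulrA _ Q) QP mulr1.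
Qed.

Lemma conj_inverse (R : pzRingType) (P Q X Y : R) :
  is_inverse P Q -> is_inverse X Y -> is_inverse (P * X * Q) (P * Y * Q).
Proof.
move=> [PQ QP] [XY YX]; split; rewrite !mulrA -(mulrA _ Q) QP mulr1 -(mulrA P).
  by rewrite XY mulr1.
by rewrite YX mulr1.
Qed.

Section InverseIdentity.
Variables (D : unitRingType) (m n : nat) (f g : {additive 'M[D]_m -> 'M[D]_m}).
Hypotheses (hD : division_ring D) (hnc : ~ commutative (@GRing.mul D)).
Hypothesis hfg : forall X Y : 'M[D]_m, is_inverse X Y -> f X = X ^+ n * g Y.

Local Notation E := (@elem_mx D m).

(** For P = Q = 1: in the j-th row of the identity on diagonal units, the
    entry x at i and the entry y at j decouple, and y^n is not constant.  The
    conjugating pair P, Q is kept general because its choice as a shear is what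
    relates the values of f on different matrix units. *)
Lemma conj_corner_row (n_gt0 : (0 < n)%N) P Q i j z : is_inverse P Q -> i != j ->
  E j j 1 * (Q * f (P * E i i z * Q)) = 0.
Proof.
move=> PQ ij; pose L (h : 'M[D]_m -> 'M[D]_m) X := E j j 1 * (Q * h (P * X * Q)).
have LB (h : {additive 'M[D]_m -> 'M[D]_m}) X Y : L h (X - Y) = L h X - L h Y.
  by rewrite /L mulrBr mulrBl raddfB !mulrBr.
have diagL x y : x != 0 -> y != 0 ->
    L f (block2 i j x 0 0 y) = y ^+ n *: L g (block2 i j x^-1 0 0 y^-1).
  move=> x0 y0; have inv := block2_diag_inverse hD ij x0 y0.
  rewrite /L (hfg (conj_inverse PQ inv)) conj_expr //.
  rewrite !mulrA -(mulrA _ Q P) PQ.2 mulr1 row_block2_diag //.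
  by rewrite -!mulrA mulr_scalemxl.
have diffL x x' y : x != 0 -> x' != 0 -> y != 0 ->
    L f (E i i (x - x')) = y ^+ n *: L g (E i i (x^-1 - x'^-1)).
  have blockB u u' v : E i i (u - u') = block2 i j u 0 0 v - block2 i j u' 0 0 v.
    by rewrite block2B !subrr !elem_mx0 !addr0.
  move=> x0 x'0 y0; rewrite (blockB _ _ y) LB !diagL // -scalerBr -LB.
  by rewrite -blockB.
(* Writing z = (z + x') - x' as a difference of nonzero elements. *)
apply/eqP/(@noncomm_nonzero_neq D (- z) _ hnc) => x' x'0 x'z.
apply/(noncomm_expr_neq1 hD hnc n_gt0) => d d0 dn.
have x0 : z + x' != 0 by rewrite addrC addr_eq0.
have Lz := diffL _ _ _ x0 x'0; rewrite addrK in Lz.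
have L1 := Lz 1 (oner_neq0 D); rewrite expr1n scale1r in L1.
have Ld := Lz d d0; rewrite -L1 in Ld.
apply/eqP/(@scale_divring_eq0 _ _ (1 - d ^+ n)) => //.
  by rewrite subr_eq0 eq_sym.
by rewrite scalerBl scale1r -[X in _ - X]Ld subrr.
Qed.

Lemma corner_row (n_gt0 : (0 < n)%N) i j z : i != j -> E j j 1 * f (E i i z) = 0.
Proof.
move=> ij; have inv11 : is_inverse (1 : 'M[D]_m) 1 by split; rewrite mulr1.
by have := conj_corner_row n_gt0 z inv11 ij; rewrite !mul1r !mulr1.
Qed.

(** Conjugating by P = 1 + E_ji(a) takes E_ii(d) to E_ii(d) + E_ji(ad), whose image
    under f therefore has j-th row equal to a times its i-th row.  Of its two
    summands, f(E_ii(d)) lives in row i and f(E_ji(ad)) in row j. *)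
Lemma shifted_corner (n_gt0 : (0 < n)%N) i j a d : j != i ->
  f (E j i (a * d)) = E j i a * f (E i i d).
Proof.
move=> ji; have ij : i != j by rewrite eq_sym.
have PQ := shear_inverse a ji.
have off_row l b : l != j -> E l l 1 * f (E j i b) = 0.
  move=> lj; have jl : j != l by rewrite eq_sym.
  (* The same shear takes e_jj to e_jj - E_ji(b). *)
  have := conj_corner_row n_gt0 1 (shear_inverse b ji) jl.
  rewrite mulrA mulrBr mulr1 (elem_mxM_neq _ _ _ _ lj) subr0.
  rewrite mulrDl mul1r (elem_mxM_neq _ _ _ _ ij) addr0.
  rewrite mulrBr mulr1 elem_mxM mul1r raddfB mulrBr corner_row // sub0r.
  by move/eqP; rewrite oppr_eq0 => /eqP.
have rowQ : E j j 1 * (1 - E j i a) = E j j 1 - E j i a.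
  by rewrite mulrBr mulr1 elem_mxM mul1r.
have conjE : (1 + E j i a) * E i i d * (1 - E j i a) = E i i d + E j i (a * d).
  rewrite mulrDl mul1r elem_mxM mulrBr mulr1 mulrDl.
  by rewrite !(elem_mxM_neq _ _ _ _ ij) addr0 subr0.
have := conj_corner_row n_gt0 d PQ ij.
rewrite conjE mulrA rowQ raddfD mulrDr !mulrBl corner_row // sub0r.
have -> : E j i a * f (E j i (a * d)) = 0.
  by rewrite -[a in E j i a]mulr1 -(elem_mxM j i i) -mulrA off_row // mulr0.
rewrite subr0 -row_supported; last by move=> l /off_row.
by move/eqP; rewrite addrC subr_eq0 => /eqP.
Qed.

(** For k = i and any j <> i, two shifts of the corner i give
    e_ji f(E_ii(a)) = f(E_ji(a)) = E_ji(a) f(e_ii); multiply by e_ij. *)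
Lemma corner_linear (m_gt1 : (1 < m)%N) (n_gt0 : (0 < n)%N) k i a :
  f (E k i a) = E k i a * f (E i i 1).
Proof.
have [->|ki] := eqVneq k i; last by rewrite -shifted_corner // mulr1.
have [j ji] := ord_exists_neq i m_gt1.
have ij : i != j by rewrite eq_sym.
rewrite [LHS](@row_supported _ _ i); last first.
  by move=> l li; rewrite corner_row // eq_sym.
have Eii : E i i 1 = E i j 1 * E j i 1 by rewrite elem_mxM mulr1.
rewrite [in LHS]Eii -mulrA -shifted_corner // mul1r -[a in LHS]mulr1.
rewrite shifted_corner // mulrA.
by rewrite elem_mxM mul1r.
Qed.

Lemma right_multiplication (m_gt1 : (1 < m)%N) (n_gt0 : (0 < n)%N) X :
  f X = X * f 1.
Proof.
have corner_f1 k i a : E k i a * f 1 = E k i a * f (E i i 1).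
  rewrite -sum_elem_mx raddf_sum mulr_sumr (bigD1 i) //= big1 ?addr0 // => l li.
  by rewrite -[a]mulr1 -(elem_mxM k i i) -mulrA corner_row // mulr0.
rewrite [X in f X]matrix_sum_delta [X in X * _]matrix_sum_delta.
rewrite raddf_sum mulr_suml; apply: eq_bigr => k _.
rewrite raddf_sum mulr_suml; apply: eq_bigr => i _.
by rewrite -/(E k i _) corner_linear // corner_f1.
Qed.

Lemma inverse_identity_sym X Y : is_inverse X Y -> g X = X ^+ n * f Y.
Proof.
move=> [XY YX]; rewrite (hfg (conj YX XY)) mulrA -exprMn_comm ?XY.
  by rewrite expr1n mul1r.
by rewrite /GRing.comm XY YX.
Qed.

End InverseIdentity.

(** * Exponent zero *)

(** Triangular units (b, ba; 0, 1) yield f(E_ij(ba)) = - g(E_ij(a)), and the units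
    (0, b; 1, c) yield g(E_ii(c b^-1)) = - f(E_jj(c)), with b occurring on the
    left only.  Subtracting b = 1 from b = d, where d is neither 0 nor 1, gives
    f(E_ij((d - 1)a)) = 0 and g(E_ii(c(d^-1 - 1))) = 0; here d - 1 and d^-1 - 1
    are invertible. *)
Lemma inverse_swap_diag_eq0 (D : unitRingType) (m : nat)
    (f g : {additive 'M[D]_m -> 'M[D]_m}) :
    division_ring D -> ~ commutative (@GRing.mul D) ->
    (forall X Y : 'M[D]_m, is_inverse X Y -> f X = g Y) ->
  forall i j z, i != j ->
    f (elem_mx i j z) = 0 /\ g (elem_mx i i z) = 0.
Proof.
move=> hD hnc hfg i j z ij.
split; apply/eqP/(@noncomm_nonzero_neq D 1 _ hnc) => d d0 d1; apply/eqP.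
  have shear a b : b != 0 -> f (elem_mx i j (b * a)) = - g (elem_mx i j a).
    move=> b0; have ub := hD _ b0.
    have inv c : is_inverse (block2 i j b (b * c) 0 1) (block2 i j b^-1 (- c) 0 1).
      apply: block2_inverse;
        rewrite // ?(mul0r, mulr0, addr0, add0r, mulr1, mul1r) ?divrr ?mulVr //.
        by rewrite mulrN addNr.
      by rewrite mulKr ?subrr.
    have := congr2 (fun U V => U - V) (hfg _ _ (inv a)) (hfg _ _ (inv 0)).
    rewrite -!raddfB !block2B !subrr !elem_mx0 mulr0 oppr0 !subr0 !addr0 !add0r.
    by move=> ->; rewrite elem_mxN raddfN.
  have ud : d - 1 \is a GRing.unit by apply: hD; rewrite subr_eq0.
  have := shear ((d - 1)^-1 * z) d d0.
  rewrite -(shear _ 1) ?oner_neq0 // => /eqP; rewrite -subr_eq0 -raddfB -elem_mxB.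
  by rewrite -mulrBl mulVKr // => /eqP.
have swap b c : b != 0 -> g (elem_mx i i (c * b^-1)) = - f (elem_mx j j c).
  move=> b0; have ub := hD _ b0.
  have inv e : is_inverse (block2 i j 0 b 1 e) (block2 i j (- (e * b^-1)) 1 b^-1 0).
    apply: block2_inverse;
      rewrite // ?(mul0r, mulr0, addr0, add0r, mulr1, mul1r) ?divrr ?mulVr //.
      by rewrite addNr.
    by rewrite mulNr divrK ?addNr.
  have := congr2 (fun U V => U - V) (hfg _ _ (inv c)) (hfg _ _ (inv 0)).
  rewrite -!raddfB !block2B !subrr !elem_mx0 mul0r oppr0 !subr0 !addr0 !add0r => ->.
  by rewrite elem_mxN raddfN opprK.
have ud : d^-1 - 1 \is a GRing.unit.
  by apply: hD; rewrite subr_eq0 -(inj_eq invr_inj) invrK invr1.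
have := swap d (z * (d^-1 - 1)^-1) d0.
rewrite -(swap 1) ?oner_neq0 // invr1 => /eqP; rewrite -subr_eq0 -raddfB -elem_mxB.
by rewrite -mulrBr divrK // => /eqP.
Qed.

Lemma inverse_swap_eq0 (D : unitRingType) (m : nat) (hm : (1 < m)%N)
    (f g : {additive 'M[D]_m -> 'M[D]_m}) :
    division_ring D -> ~ commutative (@GRing.mul D) ->
    (forall X Y : 'M[D]_m, is_inverse X Y -> f X = g Y) ->
  forall X, f X = 0.
Proof.
move=> hD hnc hfg X.
have hgf Y Z : is_inverse Y Z -> g Y = f Z.
  by move=> [YZ ZY]; rewrite (hfg Z Y).
rewrite [X]matrix_sum_delta raddf_sum big1 // => i _.
rewrite raddf_sum big1 // => j _; rewrite -/(elem_mx i j _).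
have [->|ij] := eqVneq i j.
  have [k kj] := ord_exists_neq j hm; rewrite eq_sym in kj.
  exact: (inverse_swap_diag_eq0 hD hnc hgf _ kj).2.
exact: (inverse_swap_diag_eq0 hD hnc hfg _ ij).1.
Qed.

(** * The classification *)

Theorem theorem1p2 (D : unitRingType) (hD : division_ring D)
    (hnc : ~ commutative (@GRing.mul D)) (m : nat) (hm : (1 < m)%N) (n : nat)
    (f g : {additive 'M[D]_m -> 'M[D]_m})
    (hfg : forall X Y : 'M[D]_m, is_inverse X Y -> f X = X ^+ n * g Y) :
  (n = 2%N -> f =1 g /\ (forall X : 'M[D]_m, f X = X * f 1%:M)) /\
  (n <> 2%N -> (forall X : 'M[D]_m, f X = 0) /\ (forall X : 'M[D]_m, g X = 0)).
Proof.
have hgf := inverse_identity_sym hfg.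
have [n0|n_gt0] := posnP n.
  split=> [n2|_]; first by rewrite n2 in n0.
  rewrite n0 in hfg hgf.
  have hfg0 X Y : is_inverse X Y -> f X = g Y by move/hfg; rewrite mul1r.
  have hgf0 X Y : is_inverse X Y -> g X = f Y by move/hgf; rewrite mul1r.
  by split; [apply: inverse_swap_eq0 hfg0|apply: inverse_swap_eq0 hgf0].
have fE := right_multiplication hD hnc hfg hm n_gt0.
have gE := right_multiplication hD hnc hgf hm n_gt0.
have inv11 : is_inverse (1 : 'M[D]_m) 1 by split; rewrite mulr1.
have fg1 : f 1 = g 1 by rewrite (hfg _ _ inv11) expr1n mul1r.
split=> [_|n2]; first by split=> // X; rewrite fE gE fg1.
suff f10 : f 1 = 0.
  by split=> X; [rewrite fE f10 mulr0|rewrite gE -fg1 f10 mulr0].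
have scalar (d : D) : d != 0 -> d *: f 1 = (d ^+ n * d^-1) *: f 1.
  move=> d0; have := hfg _ _ (scalar_matrix_inverse m hD d0).
  rewrite scalar_matrixX (fE (d *: _)) (gE (d^-1 *: _)) -fg1.
  by rewrite !mulr_scalemxl !mul1r scalerA.
apply/eqP/negPn/negP => /eqP f1_neq0; apply: hnc.
have sqr (d : D) : d != 0 -> d ^+ n = d ^+ 2.
  move=> d0; apply/eqP/negPn/negP => dn; apply: f1_neq0.
  apply: (scale_divring_eq0 (v := f 1 : 'M[D]_m) hD (a := d - d ^+ n * d^-1)).
    apply: contraNneq dn => /eqP; rewrite subr_eq0 => /eqP dn.
    by rewrite expr2 {2}dn divrK ?hD.
  by rewrite scalerBl -scalar // subrr.
(* Cancelling in d^n = d^2 gives exponent 1 when n = 1 and n - 2 when n > 2. *)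
have [n_lt2|n_ge2] := ltnP n 2.
  apply: (@torsion_division_ring_comm D 1) => // d d0.
  apply: (mulrI (hD _ d0)); rewrite mulr1 -expr2 -sqr //.
  by have -> : n = 1%N by apply/eqP; rewrite eqn_leq n_gt0 -ltnS n_lt2.
apply: (@torsion_division_ring_comm D (n - 2)) => //.
  by rewrite subn_gt0 ltn_neqAle n_ge2 eq_sym andbT; apply/eqP.
move=> d d0; apply: (mulrI (unitrX 2 (hD _ d0))).
by rewrite -exprD subnKC // mulr1 sqr.
Qed.
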